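(* Let $G$ be a $\sigma$-compact, locally compact group acting continuously and sharply $2$-transitively on a compact space $M$. Then both $G$ and $M$ are finite.
   Context: Compact and locally compact spaces and groups are Hausdorff. $G$ acts continuously on $M$ if the action map $G\times M\to M$ is continuous. $G$ acts sharply $2$-transitively on $M$ if the diagonal action on the set $M^{(2)}$ of pairs of distinct points of $M$ is free and transitive, where a transitive action is one with exactly one orbit (so $M^{(2)}\neq\emptyset$, i.e. $M$ has at least two points). *)

(* Defs.v *)
From HB Require Import structures.
From mathcomp Require Import all_boot.
From mathcomp Require Import all_classical topology.

Set Implicit Arguments.
Unset Strict Implicit.
Unset Printing Implicit Defensive.

Local Open Scope classical_set_scope.
Local Open Scope group_scope.

(** Topological groups; the Hausdorff axiom is not included. *)
HB.mixin Record isTopologicalGroup G of Group G & Topological G := {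
  mulg_continuous : continuous (fun x : G * G => x.1 * x.2) ;
  invg_continuous : continuous (fun x : G => x^-1)
}.

#[short(type="topologicalGroupType")]
HB.structure Definition TopologicalGroup :=
  {G of Group G & Topological G & isTopologicalGroup G}.

Definition sigma_compact (T : topologicalType) : Prop :=
  exists K : nat -> set T,
    (forall n, compact (K n)) /\ \bigcup_n K n = [set: T].

(** Left actions of arbitrary, possibly infinite, groups. *)
Section Action.
Context {G : groupType} {T : Type} (act : G -> T -> T).

Definition group_action : Prop :=
  (forall x, act 1 x = x) /\ (forall g h x, act (g * h) x = act g (act h x)).

Definition act_orbit (x : T) : set T := range (act ^~ x).

(** [act] is meant to preserve [X]; it acts on [X] by restriction. *)
Definition acts_freely_on (X : set T) : Prop :=
  forall g x, X x -> act g x = x -> g = 1.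

(** Exactly one orbit; in particular, [X] is nonempty. *)
Definition acts_transitively_on (X : set T) : Prop :=
  exists O, [set act_orbit x | x in X] = [set O].

Definition diag_act (g : G) (p : T * T) : T * T := (act g p.1, act g p.2).

End Action.

Definition distinct_pairs (T : Type) : set (T * T) := [set p | p.1 <> p.2].
Arguments distinct_pairs T : clear implicits.

Definition sharply_2_transitive (G : groupType) (T : Type)
    (act : G -> T -> T) : Prop :=
  acts_freely_on (diag_act act) (distinct_pairs T) /\
  acts_transitively_on (diag_act act) (distinct_pairs T).

Definition continuous_action (G : topologicalGroupType) (T : topologicalType)
    (act : G -> T -> T) : Prop :=
  continuous (fun p : G * T => act p.1 p.2).

(* Main.v *)
(** Fix distinct points [a] and [b]. By Baire, the continuous bijection
    [g |-> (g a, g b)] from the [sigma]-compact group [G] onto the space of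
    distinct pairs is a homeomorphism, so an ultrafilter on [G] along which
    [(g a, g b)] tends to a distinct pair converges. If an ultrafilter on [G]
    does not converge, it follows that [g y] tends along it to one and the same
    point [c] for all [y]. But take [z <> c], let [x] be the limit of [g^-1 z],
    choose [y <> x] and let [h_g] send [(a, b)] to [(g^-1 z, y)]. Then [h_g]
    converges, as does [g h_g] because it sends [(a, b)] to [(z, g y)], which
    tends to [(z, c)]; hence [g] converges, a contradiction. So [G] is compact,
    the set of distinct pairs is compact as well, the diagonal of [M] is open,
    and the compact space [M] is discrete. *)
Require Import Defs.
From mathcomp Require Import all_boot.
From mathcomp Require Import all_classical topology.

Set Implicit Arguments.
Unset Strict Implicit.
Unset Printing Implicit Defensive.

Local Open Scope classical_set_scope.

(** * Topological preliminaries: products, ultrafilters, Baire category *)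

Lemma hausdorff_prod (X Y : topologicalType) :
  hausdorff_space X -> hausdorff_space Y -> hausdorff_space (X * Y)%type.
Proof.
move=> hX hY [x1 y1] [x2 y2] clxy; congr pair.
- apply: hX => A B nA nB.
  have nfst (x : X) (y : Y) C : nbhs x C -> nbhs (x, y) (fst @^-1` C).
    by move=> nC; exact: (@cvg_fst _ _ (nbhs x) (nbhs y)).
  by have [[u v] [/= Au Bu]] := clxy _ _ (nfst _ y1 _ nA) (nfst _ y2 _ nB); exists u.
- apply: hY => A B nA nB.
  have nsnd (x : X) (y : Y) C : nbhs y C -> nbhs (x, y) (snd @^-1` C).
    by move=> nC; exact: (@cvg_snd _ _ (nbhs x) (nbhs y)).
  by have [[u v] [/= Av Bv]] := clxy _ _ (nsnd x1 _ _ nA) (nsnd x2 _ _ nB); exists v.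
Qed.

Lemma fmap_ultrafilter (T U : Type) (f : T -> U) (F : set_system T) :
  UltraFilter F -> UltraFilter (f @ F).
Proof.
move=> FU; split=> [|G GF sFG]; first exact: fmap_proper_filter.
rewrite predeqE => A; split=> [GA|]; last exact: sFG.
have [//|FnA] := in_ultra_setVsetC (f @^-1` A) FU.
have GnA : G (~` A) by exact: sFG.
by have [x []] := filter_ex (filterI GA GnA).
Qed.

Lemma compact_ultra_cvg (T : Type) (X : topologicalType) (f : T -> X)
    (F : set_system T) :
  compact [set: X] -> UltraFilter F -> exists l : X, f @ F --> l.
Proof.
rewrite compact_ultra => cX FU.
have FfU := fmap_ultrafilter f FU.
by have [l [_ ?]] := cX _ FfU (@filterT _ _ _); exists l.
Qed.

(** Baire's theorem. If no [C n] had interior points in [U], open sets could be shrunk inside [U],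
    each closure avoiding the next [C n]; by compactness the closures share a point of [U] outside
    every [C n]. *)
Lemma compact_hausdorff_baire (X : topologicalType) (U : set X)
    (C : nat -> set X) :
  hausdorff_space X -> compact [set: X] ->
  open U -> U !=set0 -> (forall n, closed (C n)) -> U `<=` \bigcup_n C n ->
  exists n, exists2 x, U x & nbhs x (C n).
Proof.
move=> hX cX oU U0 clC UC; apply: contrapT => noint.
pose good (V : set X) := [/\ open V, V !=set0 & V `<=` U].
(* Goodness is a premise inside the existential, so that [choice] yields a total function; a bad [V]
   gets the dummy value [set0]. *)
have step (nV : nat * set X) : exists W, good nV.2 ->
    good W /\ closure W `<=` nV.2 `\` C nV.1.
  case: nV => n V /=.
  have [[oV [v Vv] VU]|nV] := pselect (good V); last by exists set0.
  have [VC|/existsNP[x /not_implyP[Vx nCx]]] := pselect (V `<=` C n).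
    exfalso; apply: noint; exists n, v; first exact: VU.
    by apply: filterS VC _; exact: open_nbhs_nbhs.
  have nx : nbhs x (V `\` C n).
    by apply: filterI; apply: open_nbhs_nbhs; split=> //; exact: closed_openC.
  have [W nW clW] := @compact_regular X x setT hX cX (filterT) _ nx.
  exists W° => _; split; last first.
    by apply: subset_trans clW; apply: closureS; exact: interior_subset.
  split; [exact: open_interior|by exists x|].
  move=> y /interior_subset/subset_closure/clW[Vy _]; exact: VU.
have [f fP] := choice step.
pose V := fix V n := if n is m.+1 then f (m, V m) else U.
have gV n : good (V n) by elim: n => [|n gVn]; [split|have [] := fP (n, V n) gVn].
have clV n : closure (V n.+1) `<=` V n `\` C n by have [] := fP (n, V n) (gV n).
have decV m n : (m <= n)%N -> V n `<=` V m.
  elim: n => [|n IHn]; first by rewrite leqn0 => /eqP->.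
  rewrite leq_eqVlt => /orP[/eqP->//|/IHn VnVm x Vx].
  by apply: VnVm; have [] := clV n x (subset_closure Vx).
have FP : ProperFilter (filter_from [set: nat] V).
  apply: filter_from_proper; last by move=> n _; have [] := gV n.
  apply: filter_from_filter; first by exists 0.
  move=> m n _ _; exists (maxn m n) => // x Vx.
  by split; apply: decV Vx; rewrite ?leq_maxl ?leq_maxr.
have [x [_ clx]] := cX _ FP filterT.
have Vx n : closure (V n) x by move=> B nB; apply: clx nB; exists n.
(* The closure of [V n.+1] lies in [V n] minus [C n]: index 1 puts [x] in [V 0 = U], and index
   [n.+1] keeps it out of [C n]. *)
have [Ux _] := clV 0 x (Vx 1).
by have [n _ Cnx] := UC x Ux; have [_] := clV n x (Vx n.+1).
Qed.

(** On an infinite space the cofinite sets form a proper filter; an open point [x] cannot be a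
    cluster point of it, since [[set x]] misses the cofinite set [[set~ x]]. *)
Lemma compact_open_points_finite (X : topologicalType) :
  compact [set: X] -> (forall x : X, open [set x]) -> finite_set [set: X].
Proof.
move=> cX oX; apply: contrapT => infX.
pose F : set_system X := [set A | finite_set (~` A)].
have FP : ProperFilter F.
  split; first by rewrite /F /= setC0.
  split.
  - by rewrite /F /= setCT.
  - by move=> P Q fP fQ; rewrite /F /mkset setCI finite_setU.
  - by move=> P Q PQ; apply: sub_finite_set; exact: subsetC.
have [x [_ clx]] := cX F FP filterT.
have Fx : F [set~ x] by rewrite /F /mkset setCK; exact: finite_set1.
have nx : nbhs x [set x] by apply: open_nbhs_nbhs.
by have [y []] := clx _ _ Fx nx.
Qed.

(** * Algebra of the diagonal action on distinct pairs *)

Section SharplyTwoTransitive.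
Context {G : groupType} {T : Type} {act : G -> T -> T}.
Hypotheses (act_action : group_action act) (act_sharp : sharply_2_transitive act).
Local Open Scope group_scope.

Lemma diag_actM g h p : diag_act act (g * h) p = diag_act act g (diag_act act h p).
Proof. by rewrite /diag_act !act_action.2. Qed.

Lemma diag_act1 p : diag_act act 1 p = p.
Proof. by rewrite /diag_act !act_action.1; case: p. Qed.

Lemma diag_actK g : cancel (diag_act act g) (diag_act act g^-1).
Proof. by move=> p; rewrite -diag_actM mulVg diag_act1. Qed.

Lemma diag_act_distinct g p :
  distinct_pairs T p -> distinct_pairs T (diag_act act g p).
Proof.
rewrite /distinct_pairs /= => pD eqgp; apply: pD.
by rewrite -(diag_actK g p) /diag_act /= eqgp.
Qed.

Lemma sharp_inj p g h : distinct_pairs T p ->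
  diag_act act g p = diag_act act h p -> g = h.
Proof.
move=> pD eqp; have gh1 : g^-1 * h = 1.
  by apply: (act_sharp.1 _ p) => //; rewrite diag_actM -eqp diag_actK.
by rewrite -(mulVKg g h) gh1 mulg1.
Qed.

Lemma distinct_pairs_neq0 : distinct_pairs T !=set0.
Proof.
have [O orbO] := act_sharp.2.
have : [set O] O by [].
by rewrite -orbO => -[p pD _]; exists p.
Qed.

Lemma sharp_trans p q : distinct_pairs T p -> distinct_pairs T q ->
  exists g, diag_act act g p = q.
Proof.
have [O orbO] := act_sharp.2; move=> pD qD.
have orbE r : distinct_pairs T r -> act_orbit (diag_act act) r = O.
  by move=> rD; have : [set O] (act_orbit (diag_act act) r);
    [rewrite -orbO; exists r|].
have : act_orbit (diag_act act) p q.
  by rewrite (orbE p) // -(orbE q) //; exists 1; rewrite ?diag_act1.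
by case=> g _ <-; exists g.
Qed.

End SharplyTwoTransitive.

(** * Continuity of the diagonal action and compactness of [G] *)

Lemma distinct_pairs_open (X : topologicalType) :
  hausdorff_space X -> open (distinct_pairs X).
Proof.
move=> hX; rewrite openE => -[x y] /= /eqP xy.
move: hX; rewrite open_hausdorff => /(_ x y xy)[[A B] /= [xA yB] [oA oB AB0]].
exists (A, B) => [|[u v] [/= Au Bv] uv].
  by rewrite !inE in xA yB; split; apply: open_nbhs_nbhs.
have ABu : (A `&` B) u by split=> //; rewrite (uv : u = v).
by rewrite (eqP AB0) in ABu.
Qed.

Section ContinuousAction.
Context {G : topologicalGroupType} {M : topologicalType} {act : G -> M -> M}.
Hypotheses (act_action : group_action act)
  (act_continuous : continuous_action act) (act_sharp : sharply_2_transitive act)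
  (M_hausdorff : hausdorff_space M) (M_compact : compact [set: M])
  (G_sigma_compact : sigma_compact G).
Local Open Scope group_scope.

Lemma cvg_mulg (S : Type) (F : set_system S) (f g : S -> G) (u v : G) :
  Filter F -> f @ F --> u -> g @ F --> v -> (fun s => f s * g s) @ F --> u * v.
Proof. by move=> FF; apply: continuous2_cvg; exact: mulg_continuous (u, v). Qed.

Lemma cvg_act (S : Type) (F : set_system S) (f : S -> G) (x : S -> M) g y :
  Filter F -> f @ F --> g -> x @ F --> y -> (fun s => act (f s) (x s)) @ F --> act g y.
Proof. by move=> FF; apply: continuous2_cvg; exact: act_continuous (g, y). Qed.

Lemma diag_act_continuousl p : continuous (fun g => diag_act act g p).
Proof. by move=> g; apply: cvg_pair; apply: cvg_act => //; exact: cvg_cst. Qed.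

Lemma diag_act_continuousr g : continuous (diag_act act g).
Proof.
move=> p; apply: cvg_pair; apply: cvg_act; try exact: cvg_cst.
- by case: p => u v; exact: cvg_fst.
- by case: p => u v; exact: cvg_snd.
Qed.

Lemma pairs_hausdorff : hausdorff_space (M * M)%type.
Proof. exact: hausdorff_prod. Qed.

Lemma pairs_compact : compact [set: M * M].
Proof. by rewrite -setXTT; exact: compact_setX. Qed.

(** This replaces continuity of the inverse of the orbit map. By Baire, some compact [K n] has an
    image [C n] that is a neighbourhood of a distinct pair [x]; translating [q] to [x] by [t] traps
    [F] in the compact set [t^-1 * K n]. *)
Lemma ultra_cvg_of_pair (F : set_system G) p q :
  UltraFilter F -> distinct_pairs M p -> distinct_pairs M q ->
  (fun g => diag_act act g p) @ F --> q -> exists k : G, F --> k.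
Proof.
move=> FU pD qD Fq; have [K [cK KT]] := G_sigma_compact.
pose C n := [set diag_act act g p | g in K n].
have cptC n : compact (C n).
  by apply: continuous_compact (cK n); exact/continuous_subspaceT/diag_act_continuousl.
have clC n : closed (C n) by exact: compact_closed pairs_hausdorff (cptC n).
have coverC : distinct_pairs M `<=` \bigcup_n C n.
  move=> r rD; have [g gp] := sharp_trans act_action act_sharp pD rD.
  by have [n _ Kg] : (\bigcup_n K n) g; [rewrite KT|exists n => //; exists g].
have [n [x xD nxC]] := compact_hausdorff_baire pairs_hausdorff pairs_compact
  (distinct_pairs_open M_hausdorff) (distinct_pairs_neq0 act_sharp) clC coverC.
have [t tq] := sharp_trans act_action act_sharp qD xD.
have FK : F [set g | K n (t * g)].
  have Fx : (fun g => diag_act act t (diag_act act g p)) @ F --> x.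
    by rewrite -tq; apply: cvg_comp Fq _; exact: diag_act_continuousr.
  (* Freeness turns the equality of images of [p] under [t * g] and under [h] in [K n] into
     [t * g = h]. *)
  apply: (@filterS _ F _ _ _ _ (Fx _ nxC)) => g [h Kh]; rewrite -diag_actM //.
  by move=> /(sharp_inj act_action act_sharp pD) /= <-.
have cptK : compact ((fun g => t^-1 * g) @` K n).
  apply: continuous_compact (cK n); apply: continuous_subspaceT => g.
  by apply: cvg_mulg; [exact: cvg_cst|exact: cvg_id].
move: cptK; rewrite compact_ultra => /(_ F FU)[|k [_ Fk]]; last by exists k.
by apply: filterS FK => g Kg; exists (t * g) => //; rewrite mulKg.
Qed.

Lemma sharp_group_compact : compact [set: G].
Proof.
rewrite compact_ultra => F FU _; apply: contrapT => nocvg.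
have {}nocvg (k : G) : ~ F --> k by move=> Fk; apply: nocvg; exists k.
have [[a b] abD] := distinct_pairs_neq0 act_sharp.
(* If the limits differed, a distinct pair would tend to a distinct pair along [F], and [F] would
   converge. *)
have lims y y' (l l' : M) : y <> y' -> (fun g => act g y) @ F --> l ->
    (fun g => act g y') @ F --> l' -> l = l'.
  move=> yD Fl Fl'; apply: contrapT => lD.
  have [|k /nocvg//] := @ultra_cvg_of_pair F (y, y') (l, l') FU yD lD.
  exact: cvg_pair.
have [c Fac] := compact_ultra_cvg (fun g => act g a) M_compact FU.
have Fc y : (fun g => act g y) @ F --> c.
  have [->//|ya] := pselect (y = a).
  have [l Fl] := compact_ultra_cvg (fun g => act g y) M_compact FU.
  by rewrite -(lims y a _ _ ya Fl Fac).
have neq_ex (u : M) : exists v, v <> u.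
  by have [<-|au] := pselect (a = u); [exists b; exact: nesym|exists a].
have [z zc] := neq_ex c.
have [x Fx] := compact_ultra_cvg (fun g => act g^-1 z) M_compact FU.
have [y yx] := neq_ex x.
(* Transitivity provides [h] only when [(act g^-1 z, y)] is a distinct pair; elsewhere the value 1
   is a dummy. As [act g^-1 z] tends to [x <> y] and points are closed, the exceptional [g] are
   negligible for [F]. *)
have /choice[h hP] : forall g, exists h, act g^-1 z <> y ->
    diag_act act h (a, b) = (act g^-1 z, y).
  move=> g; have [gzy|gzy] := pselect (act g^-1 z = y); first by exists 1.
  have [h hE] :=
    @sharp_trans _ _ _ act_action act_sharp _ (act g^-1 z, y) abD gzy.
  by exists h.
have Fh : \forall g \near F, diag_act act (h g) (a, b) = (act g^-1 z, y).
  have : nbhs x (~` [set y]).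
    apply: open_nbhs_nbhs; split; last by move=> /= /esym.
    by apply/closed_openC/accessible_closed_set1/hausdorff_accessible.
  by move=> /Fx; apply: (@filterS _ F) => g /hP.
have [||k hk] := @ultra_cvg_of_pair (h @ F) _ (x, y) (fmap_ultrafilter h FU) abD.
- exact/nesym.
- have : (fun g => (act g^-1 z, y)) @ F --> (x, y).
    by apply: cvg_pair => //; exact: cvg_cst.
  by apply: cvg_trans; apply: (@near_eq_cvg _ _ F); apply: (@filterS _ F _ _ _ _ Fh) => g ->.
have [|k' hk'] :=
  @ultra_cvg_of_pair _ _ (z, c) (fmap_ultrafilter (fun g => g * h g) FU) abD zc.
- have : (fun g => (z, act g y)) @ F --> (z, c).
    by apply: cvg_pair => //; exact: cvg_cst.
  apply: cvg_trans; apply: (@near_eq_cvg _ _ F); apply: (@filterS _ F _ _ _ _ Fh) => g hE.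
  rewrite diag_actM // hE /diag_act /= -act_action.2 mulgV.
  by rewrite act_action.1.
apply: (nocvg (k' * k^-1)).
have : (fun g => (g * h g) * (h g)^-1) @ F --> k' * k^-1.
  apply: cvg_mulg => //; apply: cvg_comp hk _.
  exact: invg_continuous.
by under eq_fun do rewrite mulgK.
Qed.

End ContinuousAction.

(** * Finiteness of [M] and [G] *)

Theorem proposition5p5 (G : topologicalGroupType) (M : topologicalType)
    (act : G -> M -> M)
    (G_hausdorff : hausdorff_space G)
    (G_locally_compact : locally_compact [set: G])
    (G_sigma_compact : sigma_compact G)
    (M_hausdorff : hausdorff_space M)
    (M_compact : compact [set: M])
    (act_action : group_action act)
    (act_continuous : continuous_action act)
    (act_sharp : sharply_2_transitive act) :
  finite_set [set: G] /\ finite_set [set: M].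
Proof.
have G_compact : compact [set: G] by exact: (@sharp_group_compact G M act).
have [p pD] := distinct_pairs_neq0 act_sharp.
(* The distinct pairs form a single orbit, a continuous image of the compact group [G]. *)
have clD : closed (distinct_pairs M).
  have -> : distinct_pairs M = [set diag_act act g p | g in [set: G]].
    rewrite eqEsubset; split=> [q qD|_ [g _ <-]]; last exact: diag_act_distinct.
    by have [g <-] := sharp_trans act_action act_sharp pD qD; exists g.
  apply: compact_closed; first exact: hausdorff_prod.
  apply: continuous_compact G_compact.
  exact/continuous_subspaceT/diag_act_continuousl.
have finM : finite_set [set: M].
  apply: compact_open_points_finite => // x.
  (* A point is a slice of the diagonal, which is open as the complement of a closed set. *)
  have -> : [set x] = (fun u => (u, x)) @^-1` ~` distinct_pairs M.
    by rewrite eqEsubset; split=> u /= => [->|/contrapT] //; exact.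
  apply: open_comp; last exact: closed_openC.
  by move=> u _; apply: cvg_pair; [exact: cvg_id|exact: cvg_cst].
split=> //.
(* By freeness the orbit map of [p] embeds [G] into the finite set of all pairs. *)
rewrite -(preimage_setT (fun g => diag_act act g p)).
apply: finite_preimage; last by rewrite -setXTT; exact: finite_setX.
by move=> g h _ _; exact: sharp_inj.
Qed.
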